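(* Let $Q\subset\mathbb{R}^n$ be convex and closed, let $X_*\ne\emptyset$ be the set of minimizers of $f$ on $Q$ and $f^*=\min_{x\in Q}f(x)$. Suppose that for some $0<M<+\infty$ $$f(x)-f(x_* )\le M\,\upsilon_f(x,x_* )\qquad\forall x\in Q,\ \forall x_*\in X_*,$$ and that $f$ has an $\alpha$-sharp minimum, $\alpha>0$: $$f(x)-f^*\ge\alpha\min_{x_*\in X_*}\|x-x_*\|_2\qquad\forall x\in Q.$$ Then for any $x_0\in Q$ the method $$x_{k+1}=Pr_Q\{x_k-h_k\nabla f(x_k)\},\qquad h_k=\frac{f(x_k)-f^*}{M\|\nabla f(x_k)\|_2},\qquad k=0,1,2,\dots$$ converges at the rate of a geometric progression: for every $k\ge0$ $$\min_{x_*\in X_*}\|x_{k+1}-x_*\|_2^2\le\left(1-\frac{\alpha^2}{M^2}\right)^{k+1}\min_{x_*\in X_*}\|x_0-x_*\|_2^2 .$$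
   Context: $\|\cdot\|_2$ is the Euclidean norm and $Pr_Q$ the Euclidean projection onto $Q$. $f$ is a real-valued function defined on an open set containing $Q$, and $\nabla f(x)$ denotes a subgradient, i.e. an element of the Clarke subdifferential of $f$ at $x$, assumed to exist at every point of $Q$. It is assumed that $\nabla f(x)\ne0$ for $x\neq x_*$, $x\in Q$, $x_*\in X_*$. If $x_k\in X_*$, the solution is already found and one sets $x_{k+1}=x_k$. The quantity $\upsilon_f$ is $$\upsilon_f(x,x_* ):=\begin{cases}\left\langle\frac{\nabla f(x)}{\|\nabla f(x)\|_2},\,x-x_*\right\rangle,&x\ne x_*,\\ 0,&x=x_*,\end{cases}$$ computed with the same subgradient $\nabla f(x)$ as used in the method. *)

(* Defs.v *)
From mathcomp Require Import all_boot all_order all_algebra.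
From mathcomp Require Import all_classical all_reals all_analysis.

Set Implicit Arguments.
Unset Strict Implicit.
Unset Printing Implicit Defensive.

Import Order.TTheory GRing.Theory Num.Theory.
Import numFieldNormedType.Exports.

Local Open Scope classical_set_scope.
Local Open Scope ring_scope.

(* The library norm `|u| on 'rV[R]_n is the sup norm; it induces the Euclidean
   topology, so [closed], [open] and [nbhs] below are the usual ones, but metric
   quantities must use [enorm]. *)
Definition dotv (R : realType) (n : nat) (u v : 'rV[R]_n) : R :=
  \sum_(i < n) u 0 i * v 0 i.

Definition enorm (R : realType) (n : nat) (u : 'rV[R]_n) : R :=
  Num.sqrt (dotv u u).

(* The least element of S, as opposed to its infimum; 0 if S has none. *)
Definition setmin (R : realType) (S : set R) : R := xget 0 (S `&` lbound S).

Definition argmin_set (R : realType) (n : nat) (f : 'rV[R]_n -> R)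
    (Q : set 'rV[R]_n) : set 'rV[R]_n :=
  [set x | Q x /\ forall y, Q y -> f x <= f y].

(* 0 if z has no nearest point in Q, which does not happen for Q nonempty,
   closed and convex; the nearest point is then unique. *)
Definition eproj (R : realType) (n : nat) (Q : set 'rV[R]_n) (z : 'rV[R]_n) :
    'rV[R]_n :=
  xget 0 [set p | Q p /\ forall y, Q y -> enorm (z - p) <= enorm (z - y)].

(* Clarke's generalized directional derivative: the upper limit of
   (f (y + t v) - f y) / t as y -> x and t -> 0+ jointly. It may be infinite
   when f is not Lipschitz near x, and depends only on f near x. *)
Definition clarke_dderiv (R : realType) (n : nat) (f : 'rV[R]_n -> R)
    (x v : 'rV[R]_n) : \bar R :=
  limf_esup (fun p : 'rV[R]_n * R => ((f (p.1 + p.2 *: v) - f p.1) / p.2)%:E)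
            (filter_prod (nbhs x) (0 : R)^'+).

Definition clarke_subdiff (R : realType) (n : nat) (f : 'rV[R]_n -> R)
    (x : 'rV[R]_n) : set 'rV[R]_n :=
  [set g | forall v, ((dotv g v)%:E <= clarke_dderiv f x v)%E].

Definition upsilon (R : realType) (n : nat) (grad : 'rV[R]_n -> 'rV[R]_n)
    (x y : 'rV[R]_n) : R :=
  if x == y then 0 else dotv ((enorm (grad x))^-1 *: grad x) (x - y).

(* Main.v *)
Require Import Defs.
From mathcomp Require Import all_boot all_order all_algebra.
From mathcomp Require Import all_classical all_reals all_analysis.
From mathcomp Require Import ring lra.

Set Implicit Arguments.
Unset Strict Implicit.
Unset Printing Implicit Defensive.

Import Order.TTheory GRing.Theory Num.Theory.
Import numFieldNormedType.Exports.

Local Open Scope classical_set_scope.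
Local Open Scope ring_scope.

(* Write f* for the minimum of f on Q and d(x) for the distance from x to X_*.
   With u the normalized subgradient at x_k and t = (f(x_k) - f* ) / M, the
   hypothesis on upsilon says <u, x_k - xs> >= t for every minimizer xs, and the
   projection onto Q does not increase the distance to xs, so
     |x_{k+1} - xs|^2 <= |x_k - t u - xs|^2 <= |x_k - xs|^2 - t^2.
   The sharp minimum gives t >= (alpha / M) d(x_k); take xs nearest to x_k.
   A nearest minimizer exists because X_* is closed, although f need not be
   continuous: f - f* <= M |x - xs| holds by Cauchy-Schwarz. *)

(** * Euclidean inner product and norm, nearest points, projection onto a convex set *)

Section EuclideanNorm.
Context {R : realType} {n : nat}.
Implicit Types (u v w : 'rV[R]_n) (A Q : set 'rV[R]_n).

Lemma dotvC u v : dotv u v = dotv v u.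
Proof. by apply: eq_bigr => i _; rewrite mulrC. Qed.

Lemma dotvDl u v w : dotv (u + v) w = dotv u w + dotv v w.
Proof. by rewrite -big_split; apply: eq_bigr => i _; rewrite mxE mulrDl. Qed.

Lemma dotvZl a u v : dotv (a *: u) v = a * dotv u v.
Proof. by rewrite /dotv mulr_sumr; apply: eq_bigr => i _; rewrite mxE mulrA. Qed.

Lemma dotvDr u v w : dotv u (v + w) = dotv u v + dotv u w.
Proof. by rewrite dotvC dotvDl !(dotvC u). Qed.

Lemma dotvZr a u v : dotv u (a *: v) = a * dotv u v.
Proof. by rewrite dotvC dotvZl dotvC. Qed.

Lemma dotvNl u v : dotv (- u) v = - dotv u v.
Proof. by rewrite -scaleN1r dotvZl mulN1r. Qed.

Lemma dotvNr u v : dotv u (- v) = - dotv u v.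
Proof. by rewrite dotvC dotvNl dotvC. Qed.

Definition dotvE := (dotvDl, dotvDr, dotvNl, dotvNr, dotvZl, dotvZr).

Lemma dotv_subZ a u v : dotv (u - a *: v) (u - a *: v) =
  dotv u u - a * dotv u v *+ 2 + a ^+ 2 * dotv v v.
Proof. by rewrite !dotvE (dotvC v); ring. Qed.

Lemma dotv_ge0 u : 0 <= dotv u u.
Proof. by apply: sumr_ge0 => i _; rewrite -expr2 sqr_ge0. Qed.

Lemma dotv_eq0 u : (dotv u u == 0) = (u == 0).
Proof.
apply/idP/eqP => [|->]; last by rewrite /dotv big1// => i _; rewrite mxE mul0r.
rewrite psumr_eq0 => [/allP u0|i _]; last by rewrite -expr2 sqr_ge0.
apply/rowP => i; rewrite mxE; apply/eqP.
by have := u0 i (mem_index_enum i); rewrite /= mulf_eq0 orbb.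
Qed.

Lemma enorm_ge0 u : 0 <= enorm u.
Proof. exact: sqrtr_ge0. Qed.

Lemma sqr_enorm u : enorm u ^+ 2 = dotv u u.
Proof. by rewrite sqr_sqrtr// dotv_ge0. Qed.

Lemma enorm_eq0 u : (enorm u == 0) = (u == 0).
Proof. by rewrite -dotv_eq0 -sqr_enorm sqrf_eq0. Qed.

Lemma enorm0 : enorm (0 : 'rV[R]_n) = 0.
Proof. by apply/eqP; rewrite enorm_eq0. Qed.

Lemma ler_enorm u v : (enorm u <= enorm v) = (dotv u u <= dotv v v).
Proof. by rewrite ler_sqrt// dotv_ge0. Qed.

(** Cauchy-Schwarz: for [u != 0], expand the nonnegative square of [<u,u> v - <u,v> u] and cancel
    the factor [<u,u>]. *)
Lemma dotv_le_enorm u v : dotv u v <= enorm u * enorm v.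
Proof.
have [->|u0] := eqVneq u 0.
  by rewrite -(scale0r 0) dotvZl mul0r mulr_ge0// enorm_ge0.
have uu0 : 0 < dotv u u by rewrite lt_neqAle dotv_ge0 eq_sym dotv_eq0 u0.
have := dotv_ge0 (dotv u u *: v - dotv u v *: u).
rewrite !dotvE (dotvC v u) => H.
have {}H : 0 <= dotv u u * (dotv u u * dotv v v - dotv u v ^+ 2) by lra.
rewrite pmulr_rge0// subr_ge0 in H.
apply: le_trans (ler_norm _) _.
rewrite -(@ler_pXn2r _ 2)// ?nnegrE ?mulr_ge0 ?enorm_ge0//.
by rewrite real_normK ?num_real// exprMn !sqr_enorm.
Qed.

(** Links [enorm] to the sup norm, in which boundedness is expressed. *)
Lemma abs_coord_le_enorm u i : `|u 0 i| <= enorm u.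
Proof.
rewrite -(@ler_pXn2r _ 2)// ?nnegrE ?enorm_ge0//.
rewrite real_normK ?num_real// sqr_enorm /dotv (bigD1 i)//= -expr2 lerDl.
by apply: sumr_ge0 => j _; rewrite -expr2 sqr_ge0.
Qed.

(** Equality holds unless [u = 0], where the convention [0^-1 = 0] gives the zero vector. *)
Lemma sqr_enorm_normalize_le1 u : enorm ((enorm u)^-1 *: u) ^+ 2 <= 1.
Proof.
rewrite sqr_enorm !dotvE -sqr_enorm expr2.
have [->|u0] := eqVneq (enorm u) 0; first by rewrite invr0 !mul0r ler01.
by rewrite mulKf// mulVf.
Qed.

Lemma enorm_continuous : continuous (@enorm R n).
Proof.
move=> u; apply: continuous_comp; last exact: sqrt_continuous.
apply: continuous_big => [|i _ v]; first exact: add_continuous.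
by apply: (@cvgM _ _ (nbhs v)); exact: (@coord_continuous R 1 n 0 i v).
Qed.

Lemma enorm_sub_continuous u : continuous (fun v => enorm (u - v)).
Proof.
move=> v; apply: (@continuous_comp _ _ _ (fun v => u - v)).
  by apply: (@cvgB _ _ _ (nbhs v)); [exact: cvg_cst|exact: cvg_id].
exact: enorm_continuous.
Qed.

Definition nearest A u v := A v /\ forall w, A w -> enorm (u - v) <= enorm (u - w).

(** The part [B] of [A] at distance at most [enorm (u - a)] from [u] is compact, so the distance
    attains its minimum there; points of [A] outside [B] are farther than [a]. *)
Lemma nearest_exists A u : closed A -> A !=set0 -> exists v, nearest A u v.
Proof.
move=> clA [a Aa].
pose B := A `&` [set v | enorm (u - v) <= enorm (u - a)].
have clB : closed B.
  apply: closedI => //.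
  apply: (@preimage_closed _ _ (fun v : 'rV[R]_n => enorm (u - v))
    [set r : R | r <= enorm (u - a)]); last exact: closed_le.
  by move=> v _; exact: enorm_sub_continuous.
have bB : bounded_set B.
  exists (`|u| + enorm (u - a)); split; first exact: num_real.
  move=> b ltb v [_ /= le_va]; apply: le_trans (ltW ltb).
  have -> : v = u - (u - v) by rewrite opprB addrC subrK.
  apply: le_trans (ler_normB _ _) _; rewrite lerD2l.
  apply: le_trans le_va.
  rewrite /Num.Def.normr/= mx_normrE; apply: bigmax_le => [|[i j] _ /=].
    exact: enorm_ge0.
  by rewrite (ord1 i); exact: abs_coord_le_enorm.
have [] := @compact_EVT_min _ _ (fun v => enorm (u - v)) B.
- by exists a; split => //=.
- exact: bounded_closed_compact.
- by apply: continuous_subspaceT => v; exact: enorm_sub_continuous.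
move=> v; rewrite inE => -[Av va] minv; exists v; split=> // w Aw.
have [wa|/ltW aw] := leP (enorm (u - w)) (enorm (u - a)).
  by apply: minv; rewrite inE.
exact: le_trans aw.
Qed.

Lemma convex_segment Q u v (t : R) : convex_set Q -> Q u -> Q v ->
  0 <= t <= 1 -> Q (u + t *: (v - u)).
Proof.
move=> cQ Qu Qv /andP[t0 t1].
(* [convex_set] takes its coefficient in an interval type, so [t] is packaged with a proof that it
   lies in [0, 1]. *)
have t01 : Itv.spec (@Itv.num_sem R) (Itv.Real `[Posz 0, Posz 1]) t.
  by rewrite /Itv.spec/= /Itv.num_sem/= num_real in_itv/= t0.
have := cQ v u (Itv.mk t01); rewrite !inE => /(_ Qv Qu); congr Q.
change (t *: v + (1 - t) *: u = u + t *: (v - u)).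
by rewrite scalerBl scale1r scalerBr addrCA.
Qed.

(** Were the angle acute, moving from [p] slightly towards [y] would stay in [Q] and come closer to
    [z]. *)
Lemma nearest_obtuse Q z p y : convex_set Q -> nearest Q z p -> Q y ->
  dotv (z - p) (y - p) <= 0.
Proof.
move=> cQ [Qp minp] Qy; rewrite leNgt; apply/negP.
set r := z - p; set s := y - p; set b := dotv r s => b0.
pose c := dotv s s.
have c0 : 0 <= c := dotv_ge0 _.
(* Minimality of [p] will give [2 b <= t c]; this [t] lies in (0, 1], even when [c = 0], and
   satisfies [t c <= b], which is absurd for [b > 0]. *)
pose t := b / (b + c).
have bc0 : 0 < b + c by rewrite ltr_wpDr.
have t0 : 0 < t by rewrite divr_gt0.
have t01 : 0 <= t <= 1 by rewrite ltW//= ler_pdivrMr// mul1r lerDl.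
have := minp _ (convex_segment cQ Qp Qy t01).
rewrite ler_enorm opprD addrA -/r -/s dotv_subZ -/b -/c => H.
have {}H : t * (b *+ 2) <= t * (t * c) by lra.
rewrite ler_pM2l// in H.
have : t * c <= b.
  by rewrite /t mulrAC ler_pdivrMr// ler_pM2l// lerDr ltW.
by lra.
Qed.

(** Expand the square of [z - y = (z - p) - (y - p)]: by the obtuse angle at [p] the cross term only
    adds to the distance. *)
Lemma nearest_enorm_le Q z p y : convex_set Q -> nearest Q z p -> Q y ->
  enorm (p - y) <= enorm (z - y).
Proof.
move=> cQ np Qy; rewrite ler_enorm.
have := nearest_obtuse cQ np Qy; have := dotv_ge0 (z - p).
have -> : z - y = (z - p) - 1 *: (y - p).
  by rewrite scale1r opprB addrA subrK.
by rewrite dotv_subZ -(opprB y p) dotvNl dotvNr; lra.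
Qed.

Lemma eproj_nearest Q z : closed Q -> Q !=set0 -> nearest Q z (eproj Q z).
Proof.
move=> clQ Q0; have [p np] := nearest_exists z clQ Q0.
by rewrite /eproj; case: xgetP => [q _ //|/(_ p)]; case.
Qed.

End EuclideanNorm.

Lemma setminE (R : realType) (S : set R) m : S m -> lbound S m -> setmin S = m.
Proof.
move=> Sm lm; rewrite /setmin; case: xgetP => [q _ [Sq lq]|/(_ m)[]//].
by apply/eqP; rewrite eq_le lq//= lm.
Qed.

(** * Least distances, plain and squared, evaluated at a nearest point *)

Section Distance.
Context {R : realType} {n : nat} (A : set 'rV[R]_n).
Implicit Types u v : 'rV[R]_n.

Lemma setmin_enorm u v : nearest A u v ->
  setmin [set enorm (u - w) | w in A] = enorm (u - v).
Proof.
by move=> [Av minv]; apply: setminE => [|_ [w Aw <-]]; [exists v|exact: minv].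
Qed.

Lemma setmin_sqr_enorm u v : nearest A u v ->
  setmin [set enorm (u - w) ^+ 2 | w in A] = enorm (u - v) ^+ 2.
Proof.
move=> [Av minv]; apply: setminE => [|_ [w Aw <-]]; first by exists v.
by rewrite lerXn2r ?nnegrE ?enorm_ge0//; exact: minv.
Qed.

End Distance.

Lemma setmin_image_argmin (R : realType) n (f : 'rV[R]_n -> R) Q xs :
  argmin_set f Q xs -> setmin (f @` Q) = f xs.
Proof.
by move=> [Qxs minxs]; apply: setminE => [|_ [y Qy <-]]; [exists xs|exact: minxs].
Qed.

(** * Consequences of the bound on [f] by [upsilon] *)

Section Upsilon.
Context {R : realType} {n : nat} (f : 'rV[R]_n -> R) (Q : set 'rV[R]_n).
Context (grad : 'rV[R]_n -> 'rV[R]_n) (M : R).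
Hypothesis M_gt0 : 0 < M.
Hypothesis f_upsilon : forall x xs, Q x -> argmin_set f Q xs ->
  f x - f xs <= M * upsilon grad x xs.

Lemma upsilon_le_enorm x y : upsilon grad x y <= enorm (x - y).
Proof.
rewrite /upsilon; case: eqP => _; first exact: enorm_ge0.
apply: le_trans (dotv_le_enorm _ _) _.
rewrite ler_piMl ?enorm_ge0//.
rewrite -(@ler_pXn2r _ 2)// ?nnegrE ?enorm_ge0// expr1n.
exact: sqr_enorm_normalize_le1.
Qed.

Lemma gap_le_enorm x xs : Q x -> argmin_set f Q xs ->
  f x - f xs <= M * enorm (x - xs).
Proof.
move=> Qx Axs; apply: le_trans (f_upsilon Qx Axs) _.
by rewrite ler_pM2l// upsilon_le_enorm.
Qed.

Lemma closed_argmin_set : closed Q -> closed (argmin_set f Q).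
Proof.
move=> clQ x clx.
have Qx : Q x by apply: clQ; apply: closure_subset clx => y [].
split=> // y Qy; rewrite leNgt; apply/negP => fyx.
(* A minimizer [z] within this radius of [x] has [f x - f z < f x - f y], against [f z <= f y]. *)
have e0 : 0 < (f x - f y) / M by rewrite divr_gt0// subr_gt0.
have [|z [Az /= ltz]] := clx [set z | enorm (x - z) < (f x - f y) / M].
  have /cvgr_lt := @enorm_sub_continuous R n x x.
  by apply; rewrite /= subrr enorm0.
have := gap_le_enorm Qx Az.
rewrite ltr_pdivlMr// mulrC in ltz.
by have := (Az.2 y Qy); lra.
Qed.

Lemma subgradient_step_sqr_le x xs : Q x -> argmin_set f Q xs -> x <> xs ->
  enorm (x - ((f x - f xs) / (M * enorm (grad x))) *: grad x - xs) ^+ 2 <=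
  enorm (x - xs) ^+ 2 - ((f x - f xs) / M) ^+ 2.
Proof.
move=> Qx Axs /eqP xxs; set t := (f x - f xs) / M.
have t0 : 0 <= t by rewrite divr_ge0 ?(ltW M_gt0)// subr_ge0; apply: Axs.2.
have := f_upsilon Qx Axs; rewrite /upsilon (negbTE xxs) mulrC -ler_pdivrMr//.
(* Regrouping the step size turns the displacement into [t] times the normalized subgradient [u]. *)
rewrite invfM mulrA -scalerA -/t.
have := sqr_enorm_normalize_le1 (grad x).
set u := _^-1 *: _; set w := x - xs.
rewrite addrAC -/w !sqr_enorm dotv_subZ (dotvC w u) => uu tu.
(* In the expanded square the cross term is at most [- 2 t^2] and the quadratic term at most
   [t^2]. *)
have : t * t <= t * dotv u w by rewrite ler_wpM2l.
have : t ^+ 2 * dotv u u <= t ^+ 2 by rewrite ler_piMr// sqr_ge0.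
by lra.
Qed.

End Upsilon.

Theorem mainTheorem6 (R : realType) (n : nat)
    (U Q : set 'rV[R]_n) (f : 'rV[R]_n -> R) (grad : 'rV[R]_n -> 'rV[R]_n)
    (M alpha : R)
    (openU : open U) (subQU : Q `<=` U)
    (convexQ : convex_set Q) (closedQ : closed Q)
    (argmin_neq0 : argmin_set f Q !=set0)
    (gradP : forall x, Q x -> clarke_subdiff f x (grad x))
    (grad_neq0 : forall x xs, Q x -> argmin_set f Q xs -> x <> xs ->
       grad x <> 0)
    (M_gt0 : 0 < M)
    (f_upsilon : forall x xs, Q x -> argmin_set f Q xs ->
       f x - f xs <= M * upsilon grad x xs)
    (alpha_gt0 : 0 < alpha)
    (sharp : forall x, Q x ->
       alpha * setmin [set enorm (x - xs) | xs in argmin_set f Q]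
         <= f x - setmin (f @` Q))
    (x : nat -> 'rV[R]_n)
    (x0Q : Q (x 0%N))
    (x_stop : forall k, argmin_set f Q (x k) -> x k.+1 = x k)
    (x_step : forall k, ~ argmin_set f Q (x k) ->
       x k.+1 = eproj Q (x k - ((f (x k) - setmin (f @` Q))
                                / (M * enorm (grad (x k)))) *: grad (x k))) :
  forall k : nat,
    setmin [set enorm (x k.+1 - xs) ^+ 2 | xs in argmin_set f Q]
      <= (1 - alpha ^+ 2 / M ^+ 2) ^+ k.+1
         * setmin [set enorm (x 0%N - xs) ^+ 2 | xs in argmin_set f Q].
Proof.
have clA : closed (argmin_set f Q) by exact: (closed_argmin_set M_gt0 f_upsilon).
have dist z : exists p, nearest (argmin_set f Q) z p.
  exact: nearest_exists.
pose D z := setmin [set enorm (z - xs) ^+ 2 | xs in argmin_set f Q].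
have D_ge0 z : 0 <= D z.
  by have [p np] := dist z; rewrite /D (setmin_sqr_enorm np) sqr_ge0.
have D_argmin z : argmin_set f Q z -> D z = 0.
  move=> Az; have [p np] := dist z; rewrite /D (setmin_sqr_enorm np).
  apply/eqP; rewrite sqrf_eq0 eq_le enorm_ge0 andbT.
  have <- : enorm (z - z) = 0 by rewrite subrr enorm0.
  exact: np.2.
have Q0 : Q !=set0 by exists (x 0%N).
have xQ k : Q (x k).
  elim: k => // k IH; have [Ak|nAk] := pselect (argmin_set f Q (x k)).
    by rewrite x_stop.
  by rewrite x_step//; exact: (eproj_nearest _ closedQ Q0).1.
set c := 1 - alpha ^+ 2 / M ^+ 2.
(* The one-step contraction holds whatever the sign of [c]; at a minimizer both sides are 0. *)
have D_step k : D (x k.+1) <= c * D (x k).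
  have [Ak|nAk] := pselect (argmin_set f Q (x k)).
    by rewrite x_stop// D_argmin// mulr0 lexx.
  have [p np] := dist (x k); have [q nq] := dist (x k.+1).
  rewrite /D (setmin_sqr_enorm np) (setmin_sqr_enorm nq).
  have xp : x k <> p by move=> e; apply: nAk; rewrite e; exact: np.1.
  have := subgradient_step_sqr_le M_gt0 f_upsilon (xQ k) np.1 xp.
  have := sharp _ (xQ k); rewrite (setmin_enorm np) (setmin_image_argmin np.1).
  move=> sh step.
  have step' : enorm (x k.+1 - q) ^+ 2 <= enorm (x k - p) ^+ 2 -
      ((f (x k) - f p) / M) ^+ 2.
    (* The minimizer [q] nearest to the new iterate is no farther from it than [p], and projecting
       onto [Q] does not increase the distance to [p]. *)
    apply: le_trans step; rewrite lerXn2r ?nnegrE ?enorm_ge0//.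
    apply: le_trans (nq.2 _ np.1) _.
    rewrite x_step// (setmin_image_argmin np.1).
    apply: (nearest_enorm_le convexQ _ np.1.1).
    exact: eproj_nearest.
  apply: le_trans step' _; rewrite /c [leRHS]mulrBl mul1r lerD2l lerN2.
  rewrite -expr_div_n -exprMn lerXn2r ?nnegrE//.
  - by rewrite mulr_ge0 ?enorm_ge0// divr_ge0// ltW.
  - by rewrite divr_ge0 ?(ltW M_gt0)// subr_ge0; exact: np.1.2.
  - by rewrite mulrAC ler_pM2r ?invr_gt0.
move=> k; rewrite -/(D (x k.+1)) -/(D (x 0%N)).
(* Chaining the contractions needs [0 <= c], which is derived below from a positive distance of
   [x 0] to the minimizers; a minimizing start is settled first. *)
have [A0|nA0] := pselect (argmin_set f Q (x 0%N)).
  have Ak j : argmin_set f Q (x j) by elim: j => // j IH; rewrite x_stop.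
  by rewrite !D_argmin// mulr0 lexx.
have c_ge0 : 0 <= c.
  have [p np] := dist (x 0%N).
  have d_gt0 : 0 < enorm (x 0%N - p).
    rewrite lt_neqAle enorm_ge0 andbT eq_sym enorm_eq0 subr_eq0.
    by apply: contra_notN nA0 => /eqP ->; exact: np.1.
  (* With [d = enorm (x 0 - p) > 0], the chain [alpha d <= f (x 0) - f p <= M d] yields
     [alpha <= M]. *)
  have := le_trans (sharp _ x0Q).
  rewrite (setmin_enorm np) (setmin_image_argmin np.1).
  move=> /(_ _ (gap_le_enorm M_gt0 f_upsilon x0Q np.1)).
  rewrite ler_pM2r// => aM.
  rewrite subr_ge0 ler_pdivrMr ?exprn_gt0// mul1r.
  by rewrite lerXn2r// nnegrE ltW.
elim: k => [|k IH]; first by rewrite expr1; exact: D_step.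
apply: le_trans (D_step _) _; rewrite [c ^+ k.+2]exprS -mulrA.
exact: ler_wpM2l.
Qed.
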